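(* Let $\mathfrak{g}_\lambda$ be a generic oscillator Lie algebra and let $\xi(u)=\mathrm{ad}_u^\dagger r+2e_0\wedge\big((J+\mathrm{ad}_{u_0})(u)\big)$ be a Lie bialgebra structure on $\mathfrak{g}_\lambda$, where $r\in\wedge^2S$, $u_0\in S$ and $J$ is a derivation of $\mathfrak{g}_\lambda$ commuting with $\mathrm{ad}_{e_{-1}}$ with $J(e_{-1})=J(e_0)=0$. Let $[\;,\;]^*$ be the associated Lie bracket on $\mathfrak{g}_\lambda^*$, $[\alpha,\beta]^*(u)=\xi(u)(\alpha,\beta)$. Denote by $2p$ the dimension of the kernel of the restriction of (the skew-symmetric bilinear form) $\mathrm{ad}_{e_{-1}}^\dagger r$ to $S^*$. Then $(\mathfrak{g}_\lambda^*,[\;,\;]^* )$ is isomorphic to the semi-direct product of $\mathbb{R}e_0^*$ by the ideal $\mathcal{H}_{2(n-p)+1}\oplus\mathbb{R}^{2p}$, where $\mathcal{H}_{2(n-p)+1}$ is the $(2(n-p)+1)$-dimensional Heisenberg Lie algebra, $\mathbb{R}^{2p}$ is the $2p$-dimensional abelian Lie algebra, and the action of $e_0^*$ is given by $$[e_0^*,\alpha]^*=2J^*\alpha-2(\mathrm{ad}^*_{e_{-1}}\alpha)(u_0)\,e_{-1}^*+i_{r_\#(\alpha)}\omega\quad(\alpha\in S^* ),\qquad [e_0^*,e_{-1}^*]^*=0.$$ In particular, $(\mathfrak{g}_\lambda^*,[\;,\;]^* )$ is solvable. Moreover, $(\mathfrak{g}_\lambda^*,[\;,\;]^* )$ is unimodular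 if and only if $\sum_{i=1}^n r(e_i^*,\check e_i^* )=0$.
   Context: Lie bialgebra: a Lie algebra $\mathfrak{g}$ with a linear map $\xi:\mathfrak{g}\to\wedge^2\mathfrak{g}$ such that (1) $\xi$ is a 1-cocycle for the adjoint action, $\xi([u,v])=\mathrm{ad}_u\xi(v)-\mathrm{ad}_v\xi(u)$, and (2) the bracket on $\mathfrak{g}^*$ given by $[\alpha,\beta]^*(u)=\xi(u)(\alpha,\beta)$ satisfies the Jacobi identity. Oscillator Lie algebra: for $n\ge 1$ and $\lambda=(\lambda_1,\dots,\lambda_n)\in\mathbb{R}^n$ with $0<\lambda_1\le\dots\le\lambda_n$, $\mathfrak{g}_\lambda$ is the real Lie algebra with basis $e_{-1},e_0,e_i,\check e_i$ ($i=1,\dots,n$) and brackets $[e_{-1},e_j]=\lambda_j\check e_j$, $[e_{-1},\check e_j]=-\lambda_je_j$, $[e_j,\check e_j]=e_0$, the unspecified brackets being zero or given by antisymmetry. It is generic if $0<\lambda_1<\dots<\lambda_n$ and $\lambda_k\ne\lambda_i+\lambda_j$ for all $1\le i<j<k\le n$. Let $S=\mathrm{span}\{e_i,\check e_i\}_{i=1,\dots,n}$. Let $\omega$ be the 2-form on $\mathfrak{g}_\lambda$ with $i_{e_{-1}}\omega=i_{e_0}\omega=0$, $\omega(e_i,e_j)=\omega(\check e_i,\check e_j)=0$, $\omega(e_i,\check e_j)=\delta_{ij}$, where $i_v\omega=\omega(v,\cdot)$. Let $e_{-1}^*,e_0^*,e_i^*,\check e_i^*$ be the dual basis, and $S^*=\{\alpha\in\mathfrak{g}_\lambda^*:\alpha(e_{-1})=\alpha(e_0)=0\}$.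 Elements $r\in\wedge^2\mathfrak{g}_\lambda$ are regarded as skew-symmetric bilinear forms on $\mathfrak{g}_\lambda^*$, with $(v\wedge w)(\alpha,\beta)=\alpha(v)\beta(w)-\alpha(w)\beta(v)$; $r_\#:\mathfrak{g}_\lambda^*\to\mathfrak{g}_\lambda$ is defined by $\beta(r_\#(\alpha))=r(\alpha,\beta)$. By $\wedge^2S$ is meant the space of $r\in\wedge^2\mathfrak{g}_\lambda$ with $r_\#(e_{-1}^* )=r_\#(e_0^* )=0$. For an endomorphism $J$ of $\mathfrak{g}_\lambda$, $J^*\alpha=\alpha\circ J$ and $(J^\dagger r)(\alpha,\beta)=r(J^*\alpha,\beta)+r(\alpha,J^*\beta)$; in particular $\mathrm{ad}_u^*\alpha=\alpha\circ\mathrm{ad}_u$, and $\mathrm{ad}_u^\dagger$ is the adjoint action of $u$ on $\wedge^2\mathfrak{g}_\lambda$. A Lie algebra is unimodular if all its operators $\mathrm{ad}_x$ have trace zero. The one-dimensional Heisenberg Lie algebra $\mathcal{H}_1$ is $\mathbb{R}$. *)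

(* Defs.v *)
From HB Require Import structures.
From mathcomp Require Import all_boot all_order all_algebra.
From mathcomp Require Import ring reals.

Set Implicit Arguments.
Unset Strict Implicit.
Unset Printing Implicit Defensive.

Import Order.TTheory GRing.Theory Num.Theory.
Local Open Scope ring_scope.

Lemma linfunE_of (F : fieldType) (V W : vectType F) (f : V -> W) :
  linear f -> linfun f =1 f.
Proof.
move=> lf x.
pose fM := GRing.isLinear.Build _ _ _ _ f lf.
pose fL : {linear V -> W} := HB.pack f fM.
by rewrite -[f]/(fL : V -> W) lfunE.
Qed.

(* A Lie algebra is a [vectType] together with an operation satisfying
   [is_lie_bracket]; the operation is kept apart from the carrier because the
   bracket on a dual space depends on the cobracket. *)

Section Lie.
Variable F : fieldType.
Implicit Types V W A I : vectType F.

Definition is_lie_bracket V (br : V -> V -> V) : Prop :=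
  [/\ forall u, linear (br u),
      forall v, linear (br^~ v),
      forall u, br u u = 0
    & forall u v w, br u (br v w) + br v (br w u) + br w (br u v) = 0].

Definition ad V (br : V -> V -> V) (u : V) : 'End(V) := linfun (br u).

Lemma adE V (br : V -> V -> V) : is_lie_bracket br -> forall u v, ad br u v = br u v.
Proof. by case=> brl _ _ _ u v; rewrite /ad linfunE_of. Qed.

Definition is_derivation V (br : V -> V -> V) (D : 'End(V)) : Prop :=
  forall u v, D (br u v) = br (D u) v + br u (D v).

Definition lie_iso V W (brV : V -> V -> V) (brW : W -> W -> W)
    (phi : 'Hom(V, W)) : Prop :=
  bijective phi /\ forall u v, phi (brV u v) = brW (phi u) (phi v).

(* The span of all brackets [br u w], u in U, w in W, when [br] is bilinear;
   see [memv_lie_comm] and [lie_comm_min]. *)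
Definition lie_comm V (br : V -> V -> V) (U W : {vspace V}) : {vspace V} :=
  <<[seq br u w | u <- vbasis U, w <- vbasis W]>>%VS.

Lemma memv_lie_comm V (br : V -> V -> V) (U W : {vspace V}) u w :
  is_lie_bracket br -> u \in U -> w \in W -> br u w \in lie_comm br U W.
Proof.
case=> brl brr _ _ uU wW.
pose l1 x := HB.pack_for {linear V -> V} (br x) (GRing.isLinear.Build _ _ _ _ (br x) (brl x)).
pose l2 y := HB.pack_for {linear V -> V} (br^~ y) (GRing.isLinear.Build _ _ _ _ (br^~ y) (brr y)).
rewrite (coord_vbasis uU) -[br _ w]/(l2 w _) linear_sum.
apply: memv_suml => i _; rewrite linearZ; apply: memvZ => /=.
rewrite (coord_vbasis wW) -[br _ _]/(l1 _ _) linear_sum.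
apply: memv_suml => j _; rewrite linearZ; apply: memvZ => /=.
by apply/memv_span/allpairs_f; rewrite mem_nth// size_tuple.
Qed.

Lemma lie_comm_min V (br : V -> V -> V) (U W X : {vspace V}) :
  (forall u w, u \in U -> w \in W -> br u w \in X) -> (lie_comm br U W <= X)%VS.
Proof.
move=> brX; apply/span_subvP => v /allpairsP[[u w] /= [uU wW ->]].
by apply: brX; apply: vbasis_mem.
Qed.

Definition derived_series V (br : V -> V -> V) (k : nat) : {vspace V} :=
  iter k (fun U => lie_comm br U U) {:V}%VS.

Definition lie_solvable V (br : V -> V -> V) : Prop :=
  exists k, derived_series br k = 0%VS.

Definition lfun_trace V (f : 'End(V)) : F :=
  \tr (passmx.mxof (vbasis {:V}) (vbasis {:V}) f).

Definition unimodular V (br : V -> V -> V) : Prop :=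
  forall u, lfun_trace (ad br u) = 0.

Definition abelian_br V (u v : V) : V := 0.

Definition prod_br V W (brV : V -> V -> V) (brW : W -> W -> W)
    (u v : V * W) : V * W := (brV u.1 v.1, brW u.2 v.2).

Definition is_lie_action A I (brA : A -> A -> A) (brI : I -> I -> I)
    (rho : 'Hom(A, 'End(I))) : Prop :=
  (forall a, is_derivation brI (rho a)) /\
  (forall a b, rho (brA a b) = (rho a \o rho b)%VF - (rho b \o rho a)%VF).

Definition sdprod_br A I (brA : A -> A -> A) (brI : I -> I -> I)
    (rho : 'Hom(A, 'End(I))) (u v : A * I) : A * I :=
  (brA u.1 v.1, brI u.2 v.2 + rho u.1 v.2 - rho v.1 u.2).

Lemma abelian_br_lie V : is_lie_bracket (@abelian_br V).
Proof.
by split=> *; rewrite /abelian_br ?addr0//; move=> a x y; rewrite scaler0 addr0.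
Qed.

Definition dual V : vectType F := 'Hom(V, F^o).

Definition dform V : vectType F := 'Hom(dual V, 'Hom(dual V, F^o)).

(* Elements of wedge^2 V, as skew-symmetric bilinear forms on [dual V]. *)
Definition skew V (r : dform V) : Prop := forall a b : dual V, r a b = - r b a.

Definition mk_dform V (f : dual V -> dual V -> F) : dform V :=
  linfun (fun a => linfun (f a : dual V -> F^o)).

Lemma mk_dformE V (f : dual V -> dual V -> F) :
  (forall a, linear (f a : dual V -> F^o)) ->
  (forall b, linear (f^~ b : dual V -> F^o)) ->
  forall a b, mk_dform f a b = f a b.
Proof.
move=> fl fr a b; rewrite /mk_dform linfunE_of ?linfunE_of// => k x y.
apply/lfunP => z; rewrite add_lfunE scale_lfunE !linfunE_of//.
exact: (fr z).
Qed.

Definition wedge V (v w : V) : dform V :=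
  mk_dform (fun a b => a v * b w - a w * b v).

Lemma wedgeE V (v w : V) a b : wedge v w a b = a v * b w - a w * b v.
Proof.
rewrite /wedge mk_dformE// => c k x y; rewrite !(add_lfunE, scale_lfunE)/=.
  by rewrite !mulrDr opprD addrACA scalerBr -!scalerAr.
by rewrite !mulrDl opprD addrACA scalerBr -!scalerAl.
Qed.

Definition lstar V (J : 'End(V)) (a : dual V) : dual V := (a \o J)%VF.

Lemma lstarE V (J : 'End(V)) (a : dual V) u : lstar J a u = a (J u).
Proof. by rewrite comp_lfunE. Qed.

Lemma lstarD V (J : 'End(V)) k (a b : dual V) :
  lstar J (k *: a + b) = k *: lstar J a + lstar J b.
Proof. by apply/lfunP => u; rewrite !(add_lfunE, scale_lfunE, comp_lfunE). Qed.

Definition dagger V (J : 'End(V)) (r : dform V) : dform V :=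
  mk_dform (fun a b => r (lstar J a) b + r a (lstar J b)).

Lemma daggerE V (J : 'End(V)) (r : dform V) a b :
  dagger J r a b = r (lstar J a) b + r a (lstar J b).
Proof.
rewrite /dagger mk_dformE// => c k x y.
  by rewrite lstarD !linearP scalerDr addrACA.
by rewrite lstarD !linearP !(add_lfunE, scale_lfunE) scalerDr addrACA.
Qed.

(* [r_# alpha], the vector such that [beta (r_# alpha) = r alpha beta];
   see [sharpE]. *)
Definition sharp V (r : dform V) (a : dual V) : V :=
  \sum_(i < \dim {:V}) r a (linfun (coord (vbasis {:V}) i : V -> F^o))
                       *: (vbasis {:V})`_i.

Lemma sharpE V (r : dform V) (a b : dual V) : b (sharp r a) = r a b.
Proof.
rewrite /sharp linear_sum/=.
have {2}-> : b = \sum_(i < \dim {:V}) b (vbasis {:V})`_i *: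
    linfun (coord (vbasis {:V}) i : V -> F^o).
  apply/lfunP => u; rewrite {1}(coord_vbasis (memvf u)) linear_sum sum_lfunE.
  apply: eq_bigr => i _.
  rewrite linearZ/= scale_lfunE linfunE_of; last exact: linearP.
  exact: mulrC.
rewrite linear_sum; apply: eq_bigr => i _.
by rewrite !linearZ/=; exact: mulrC.
Qed.

Definition dual_br V (xi : 'Hom(V, dform V)) (a b : dual V) : dual V :=
  linfun (fun u => xi u a b).

Lemma dual_brE V (xi : 'Hom(V, dform V)) (a b : dual V) u :
  dual_br xi a b u = xi u a b.
Proof.
by rewrite /dual_br linfunE_of// => k x y; rewrite linearP !(add_lfunE, scale_lfunE).
Qed.

Definition is_lie_bialgebra V (br : V -> V -> V) (xi : 'Hom(V, dform V)) : Prop :=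
  [/\ is_lie_bracket br,
      forall u, skew (xi u),
      forall u v, xi (br u v) = dagger (ad br u) (xi v) - dagger (ad br v) (xi u)
    & forall a b c : dual V,
        dual_br xi a (dual_br xi b c) + dual_br xi b (dual_br xi c a)
        + dual_br xi c (dual_br xi a b) = 0].

Lemma dual_br_lie V (br : V -> V -> V) (xi : 'Hom(V, dform V)) :
  2%:R != 0 :> F -> is_lie_bialgebra br xi -> is_lie_bracket (dual_br xi).
Proof.
move=> two0 [_ sk _ jac]; split=> //.
- move=> a k b c; apply/lfunP => u.
  by rewrite !(dual_brE, add_lfunE, scale_lfunE, linearP).
- move=> a k b c; apply/lfunP => u.
  by rewrite !(dual_brE, add_lfunE, scale_lfunE, linearP).
move=> a; apply/lfunP => u; rewrite dual_brE zero_lfunE.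
have /eqP := sk u a a; rewrite -addr_eq0 -mulr2n -mulr_natl mulf_eq0.
by rewrite (negPf two0) => /eqP.
Qed.

(* The kernel of the restriction to W of the bilinear form [b], that is
   [{alpha in W | forall beta in W, b alpha beta = 0}]; see [mem_radical]. *)
Definition radical V (W : {vspace dual V}) (b : dform V) : {vspace dual V} :=
  (W :&: \bigcap_(i < \dim W)
     lker (linfun (fun a : dual V => b a (vbasis W)`_i)))%VS.

Lemma mem_radical V (W : {vspace dual V}) (b : dform V) a :
  reflect (a \in W /\ forall c, c \in W -> b a c = 0) (a \in radical W b).
Proof.
have bE i : linfun (fun a : dual V => b a (vbasis W)`_i) =1
    (fun a => b a (vbasis W)`_i).
  by apply: linfunE_of => k x y; rewrite linearP !(add_lfunE, scale_lfunE).
rewrite memv_cap; apply: (iffP andP) => -[aW h]; split=> //.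
  move=> c cW; rewrite (coord_vbasis cW) linear_sum big1// => i _.
  rewrite linearZ/=.
  have /subv_bigcapP/(_ i isT) := h.
  by rewrite -memvE memv_ker bE => /eqP ->; rewrite scaler0.
rewrite memvE; apply/subv_bigcapP => i _; rewrite -memvE memv_ker bE h//.
by rewrite vbasis_mem// mem_nth// size_tuple.
Qed.

End Lie.

(* The Heisenberg Lie algebra of dimension 2m+1: [(z, (x, y))] has coordinate z
   on the central basis vector and x, y on basis vectors a_i, b_i whose brackets
   [a_i, b_i] are that central vector; R itself when m = 0. *)

Definition heis (R : realType) (m : nat) : vectType R :=
  (R^o * ('rV[R]_m * 'rV[R]_m))%type.

Definition heis_br (R : realType) (m : nat) (u v : heis R m) : heis R m :=
  (\sum_(i < m) (u.2.1 0 i * v.2.2 0 i - u.2.2 0 i * v.2.1 0 i), (0, 0)).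

Lemma heis_br_lie (R : realType) (m : nat) : is_lie_bracket (@heis_br R m).
Proof.
split.
- move=> u k v w; congr (_, _); last first.
    by rewrite -[LHS]/(0 : 'rV_m * 'rV_m) -[RHS]/(k *: (0 : 'rV_m * 'rV_m) + 0)
      scaler0 addr0.
  rewrite -[RHS]/(k * _ + _) mulr_sumr -big_split/=.
  by apply: eq_bigr => i _; rewrite !mxE; ring.
- move=> u k v w; congr (_, _); last first.
    by rewrite -[LHS]/(0 : 'rV_m * 'rV_m) -[RHS]/(k *: (0 : 'rV_m * 'rV_m) + 0)
      scaler0 addr0.
  rewrite -[RHS]/(k * _ + _) mulr_sumr -big_split/=.
  by apply: eq_bigr => i _; rewrite !mxE; ring.
- by move=> u; congr (_, _); rewrite big1// => i _; ring.
- move=> u v w; congr (_, _); last first.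
    by rewrite -[LHS]/((0 : 'rV_m * 'rV_m) + 0 + 0) !addr0.
  by rewrite /= -!big_split/= big1// => i _; rewrite !mxE; ring.
Qed.

Section Oscillator.
Variables (R : realType) (n : nat).

(* [((a, b), (x, y))] stands for
   [a e_{-1} + b e_0 + \sum_i (x_i e_i + y_i \check e_i)]. *)
Definition osc : vectType R := ((R^o * R^o) * ('rV[R]_n * 'rV[R]_n))%type.

Definition em1 : osc := ((1, 0), (0, 0)).
Definition e0 : osc := ((0, 1), (0, 0)).
Definition ei (i : 'I_n) : osc := ((0, 0), (delta_mx 0 i, 0)).
Definition ec (i : 'I_n) : osc := ((0, 0), (0, delta_mx 0 i)).

(* The bilinear extension of the brackets [osc_br_em1_ei], [osc_br_em1_ec],
   [osc_br_ei_ec] below. *)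
Definition osc_br (lam : 'I_n -> R) (u v : osc) : osc :=
  ((0, \sum_(i < n) (u.2.1 0 i * v.2.2 0 i - u.2.2 0 i * v.2.1 0 i)),
   (\row_i (- lam i * (u.1.1 * v.2.2 0 i - v.1.1 * u.2.2 0 i)),
    \row_i (lam i * (u.1.1 * v.2.1 0 i - v.1.1 * u.2.1 0 i)))).

Definition generic (lam : 'I_n -> R) : Prop :=
  [/\ forall i, 0 < lam i,
      forall i j : 'I_n, (i < j)%N -> lam i < lam j
    & forall i j k : 'I_n, (i < j)%N -> (j < k)%N -> lam k != lam i + lam j].

Definition em1_dual : dual osc := linfun (fun u : osc => u.1.1).
Definition e0_dual : dual osc := linfun (fun u : osc => u.1.2).
Definition ei_dual (i : 'I_n) : dual osc := linfun (fun u : osc => u.2.1 0 i : R^o).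
Definition ec_dual (i : 'I_n) : dual osc := linfun (fun u : osc => u.2.2 0 i : R^o).

Definition oscS : {vspace osc} :=
  (<<[seq ei i | i : 'I_n]>> + <<[seq ec i | i : 'I_n]>>)%VS.

(* Linear forms vanishing on [em1] and [e0]; see [mem_oscSd]. *)
Definition oscSd : {vspace dual osc} :=
  (lker (linfun (fun a : dual osc => a em1)) :&:
   lker (linfun (fun a : dual osc => a e0)))%VS.

Definition omega (u v : osc) : R :=
  \sum_(i < n) (u.2.1 0 i * v.2.2 0 i - u.2.2 0 i * v.2.1 0 i).

Definition iomega (v : osc) : dual osc := linfun (omega v : osc -> R^o).

Definition wedge2S (r : dform osc) : Prop :=
  [/\ skew r, sharp r em1_dual = 0 & sharp r e0_dual = 0].

End Oscillator.

Arguments em1 {R n}.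
Arguments e0 {R n}.
Arguments ei {R n} i.
Arguments ec {R n} i.
Arguments em1_dual {R n}.
Arguments e0_dual {R n}.
Arguments ei_dual {R n} i.
Arguments ec_dual {R n} i.
Arguments oscS {R n}.
Arguments oscSd {R n}.

Section OscillatorTheory.
Variables (R : realType) (n : nat).
Implicit Types (u v w : osc R n) (lam : 'I_n -> R).

Lemma osc_eqP u v : u.1.1 = v.1.1 -> u.1.2 = v.1.2 ->
  (forall i, u.2.1 0 i = v.2.1 0 i) -> (forall i, u.2.2 0 i = v.2.2 0 i) -> u = v.
Proof.
case: u => [[a b] [x y]]; case: v => [[a' b'] [x' y']] /= -> -> hx hy.
by congr (_, (_, _)); apply/rowP.
Qed.

Lemma em1_dualE u : em1_dual u = u.1.1.
Proof. by rewrite linfunE_of. Qed.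

Lemma e0_dualE u : e0_dual u = u.1.2.
Proof. by rewrite linfunE_of. Qed.

Lemma ei_dualE i u : ei_dual i u = u.2.1 0 i.
Proof. by rewrite linfunE_of// => k x y; rewrite /= !mxE. Qed.

Lemma ec_dualE i u : ec_dual i u = u.2.2 0 i.
Proof. by rewrite linfunE_of// => k x y; rewrite /= !mxE. Qed.

Lemma mem_oscSd (a : dual (osc R n)) :
  reflect (a em1 = 0 /\ a e0 = 0) (a \in oscSd).
Proof.
have E (w : osc R n) : linfun (fun a : dual (osc R n) => a w) =1 (fun a => a w).
  by apply: linfunE_of => k x y; rewrite add_lfunE scale_lfunE.
by rewrite memv_cap !memv_ker !E; apply: (iffP andP) => -[/eqP-> /eqP->].
Qed.

Lemma iomegaE v u : iomega v u = omega v u.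
Proof.
rewrite /iomega linfunE_of// => k x y; rewrite /omega.
rewrite -[RHS]/(k * _ + _) mulr_sumr -big_split/=.
by apply: eq_bigr => i _; rewrite !mxE; ring.
Qed.

Lemma osc_br_em1_ei lam j : osc_br lam em1 (ei j) = lam j *: ec j.
Proof.
apply: osc_eqP => [||i|i] /=; rewrite ?scaler0//.
- by rewrite big1// => i _; rewrite !mxE !mul0r subr0.
- by rewrite !mxE !mul0r mulr0 subr0 !mulr0.
rewrite !mxE eqxx mul0r subr0 mul1r /=.
by case: eqP => [->//|]; rewrite !mulr0.
Qed.

Lemma osc_br_em1_ec lam j : osc_br lam em1 (ec j) = - lam j *: ei j.
Proof.
apply: osc_eqP => [||i|i] /=; rewrite ?scaler0//.
- by rewrite big1// => i _; rewrite !mxE !mul0r subr0.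
- rewrite !mxE eqxx mul0r subr0 mul1r /=.
  by case: eqP => [->//|]; rewrite !mulr0.
by rewrite !mxE !mul0r mulr0 subr0 !mulr0.
Qed.

Lemma osc_br_ei_ec lam i j : osc_br lam (ei i) (ec j) = (i == j)%:R *: e0.
Proof.
apply: osc_eqP => [||k|k] /=.
- by rewrite scaler0.
- rewrite (bigD1 i)//= big1 => [|k ki]; rewrite !mxE !eqxx/=.
    by rewrite mul1r mul0r subr0 addr0; exact: (esym (mulr1 _)).
  by rewrite (negPf ki) !mul0r subr0.
- by rewrite !mxE; ring.
- by rewrite !mxE; ring.
Qed.

Lemma osc_br_ei_ei lam i j : osc_br lam (ei i) (ei j) = 0.
Proof.
apply: osc_eqP => [||k|k] //=; try by rewrite !mxE; ring.
by rewrite big1// => k _; rewrite !mxE; ring.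
Qed.

Lemma osc_br_ec_ec lam i j : osc_br lam (ec i) (ec j) = 0.
Proof.
apply: osc_eqP => [||k|k] //=; try by rewrite !mxE; ring.
by rewrite big1// => k _; rewrite !mxE; ring.
Qed.

Lemma osc_br_e0 lam u : osc_br lam e0 u = 0.
Proof.
apply: osc_eqP => [||k|k] //=; try by rewrite !mxE; ring.
by rewrite big1// => k _; rewrite !mxE; ring.
Qed.

Lemma osc_br_lie lam : is_lie_bracket (osc_br lam).
Proof.
split.
- move=> u k v w; apply: osc_eqP => [||i|i] /=; rewrite ?mxE/=.
  + by rewrite scaler0 addr0.
  + rewrite -[RHS]/(k * _ + _) mulr_sumr -big_split/=.
    by apply: eq_bigr => i _; rewrite !mxE; ring.
  + by rewrite -[k *: v.1.1]/(k * v.1.1); ring.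
  + by rewrite -[k *: v.1.1]/(k * v.1.1); ring.
- move=> u k v w; apply: osc_eqP => [||i|i] /=; rewrite ?mxE/=.
  + by rewrite scaler0 addr0.
  + rewrite -[RHS]/(k * _ + _) mulr_sumr -big_split/=.
    by apply: eq_bigr => i _; rewrite !mxE; ring.
  + by rewrite -[k *: v.1.1]/(k * v.1.1); ring.
  + by rewrite -[k *: v.1.1]/(k * v.1.1); ring.
- move=> u; apply: osc_eqP => [||i|i] //=; rewrite ?mxE/=; try by ring.
  by rewrite big1// => i _; ring.
- move=> u v w; apply: osc_eqP => [||i|i] /=; rewrite ?mxE/=.
  + by rewrite !addr0.
  + rewrite -!big_split/= big1// => i _; rewrite !mxE; ring.
  + by ring.
  + by ring.
Qed.

End OscillatorTheory.

(* Main.v *)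
Require Import Defs.
From mathcomp Require Import all_boot all_order all_algebra reals.
From mathcomp Require Import ring boolp.
Import GRing.Theory Num.Theory.
Local Open Scope ring_scope.

(** Write [B] for the form [dagger (ad em1) r]. The coadjoint operator of [u] sends
[a] to [u.1.1 (a \o ad em1) - a(osc_br em1 u) em1_dual + a(e0) (iomega u)]
([lstar_ad]), and [r] vanishes on [em1_dual] and [e0_dual]; substituting this in the
definition of the cobracket gives the bracket of the dual in closed form
([dual_brS]): [[a, b] = B(a, b) em1_dual + a(e0) D(b) - b(e0) D(a)], where
[D(a) = iomega (sharp r a) + 2 a \o (J + ad u0)]. Moreover [D] kills [em1_dual],
because [J] and [ad u0] have no component along [em1], and [D(a)] vanishes at [e0].

Everything is read off this formula. The forms that vanish at [e0] make up an ideal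
spanned by the central element [em1_dual] and [oscSd], on which the bracket is [B]
times [em1_dual]. Darboux coordinates for [B] on [oscSd]
([symplectic_coordinates]) turn this ideal into a Heisenberg algebra plus the kernel
of [B]; as [oscSd] has dimension [2n], the kernel has even dimension. The
complement is the line of [e0_dual], acting by [D], and the Jacobi identity of the
dual bracket says that [D] is a derivation ([lie_split_sdprod]). The derived series
vanishes after three steps. Finally, only [e0_dual] can act with nonzero trace:
[a \o J] has trace zero since [J] is infinitesimally symplectic,
[a \o ad u0] has zero diagonal entries, and [iomega (sharp r a)] has trace
[-2 \sum_i r (ei_dual i) (ec_dual i)]. *)

Set Implicit Arguments.
Unset Strict Implicit.
Unset Printing Implicit Defensive.

(** * Symplectic coordinates for a degenerate alternating form *)

Section Symplectic.
Variables (F : fieldType) (V : vectType F) (B : 'Hom(V, 'Hom(V, F^o))).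
Hypothesis alt : forall v, B v v = 0.

Lemma alt_anti u v : B u v = - B v u.
Proof.
have := alt (u + v).
rewrite !linearD /= !add_lfunE !alt add0r addr0 addrC => /eqP.
by rewrite addr_eq0 => /eqP ->.
Qed.

Definition hyperbolic m (a b : 'I_m -> V) :=
  [/\ forall i j, B (a i) (a j) = 0, forall i j, B (b i) (b j) = 0
    & forall i j, B (a i) (b j) = (i == j)%:R].

Definition hyp_comb m (a b : 'I_m -> V) (x y : 'I_m -> F) : V :=
  \sum_i x i *: a i + \sum_i y i *: b i.

Lemma sum_delta (K : finType) (i : K) (x : K -> F) :
  \sum_j x j * (j == i)%:R = x i.
Proof.
rewrite (bigD1 i) //= eqxx mulr1 big1 ?addr0 // => j /negPf ->.
by rewrite mulr0.
Qed.

Lemma form_suml (K : finType) (x : K -> F) (c : K -> V) v :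
  B (\sum_i x i *: c i) v = \sum_i x i * B (c i) v.
Proof.
by rewrite linear_sum sum_lfunE; apply: eq_bigr => i _; rewrite linearZ scale_lfunE.
Qed.

Lemma hyp_comb_a m (a b : 'I_m -> V) x y j : hyperbolic a b ->
  B (hyp_comb a b x y) (a j) = - y j.
Proof.
case=> aa _ ab; rewrite linearD add_lfunE !form_suml.
rewrite big1 => [|i _]; last by rewrite aa mulr0.
rewrite add0r -(sum_delta j) -sumrN; apply: eq_bigr => i _.
by rewrite alt_anti ab mulrN eq_sym.
Qed.

Lemma hyp_comb_b m (a b : 'I_m -> V) x y j : hyperbolic a b ->
  B (hyp_comb a b x y) (b j) = x j.
Proof.
case=> _ bb ab; rewrite linearD add_lfunE !form_suml.
rewrite [X in _ + X]big1 => [|i _]; last by rewrite bb mulr0.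
by rewrite addr0 -(sum_delta j); apply: eq_bigr => i _; rewrite ab.
Qed.

(** The component of [v] orthogonal to a hyperbolic family, so that the family
spans a subspace that splits off orthogonally. *)
Definition residual m (a b : 'I_m -> V) v :=
  v - hyp_comb a b (fun i => B v (b i)) (fun i => - B v (a i)).

Lemma residual_a m (a b : 'I_m -> V) v j : hyperbolic a b ->
  B (residual a b v) (a j) = 0.
Proof.
by move=> h; rewrite linearB /= add_lfunE opp_lfunE hyp_comb_a // opprK subrr.
Qed.

Lemma residual_b m (a b : 'I_m -> V) v j : hyperbolic a b ->
  B (residual a b v) (b j) = 0.
Proof.
by move=> h; rewrite linearB /= add_lfunE opp_lfunE hyp_comb_b // subrr.
Qed.

Lemma residualK m (a b : 'I_m -> V) u v : hyperbolic a b ->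
  B (residual a b u) (residual a b v) = B (residual a b u) v.
Proof.
move=> h; have := residual_a u ^~ h; have := residual_b u ^~ h.
move: (residual a b u) => t tb ta; rewrite /residual linearB /hyp_comb linearD /=.
rewrite !linear_sum !big1 ?addr0 ?subr0 // => i _.
  by rewrite linearZ /= tb scaler0.
by rewrite linearZ /= ta scaler0.
Qed.

Lemma memv_hyp_comb m (a b : 'I_m -> V) x y (W : {vspace V}) :
  (forall i, a i \in W) -> (forall i, b i \in W) -> hyp_comb a b x y \in W.
Proof. by move=> aW bW; rewrite rpredD // rpred_sum // => i _; rewrite rpredZ. Qed.

Lemma hyperbolic_leq m (a b : 'I_m -> V) : hyperbolic a b -> (m <= \dim {:V})%N.
Proof.
move=> h; pose X := [tuple a i | i < m].
have : free X.
  apply/freeP => k k0 i.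
  rewrite -(hyp_comb_b k (fun=> 0) i h) /hyp_comb.
  rewrite [X in _ + X]big1 ?addr0 => [|j _]; last by rewrite scale0r.
  rewrite (eq_bigr (fun i : 'I_m => k i *: X`_i)) ?k0 ?linear0 ?zero_lfunE //.
  by move=> j _; rewrite -tnth_nth tnth_mktuple.
by rewrite /free size_tuple => /eqP <-; apply/dimvS/subvf.
Qed.

Lemma hyperbolic_extend m (a b : 'I_m -> V) v w :
  hyperbolic a b -> (forall i, B v (a i) = 0) -> (forall i, B v (b i) = 0) ->
  (forall i, B w (a i) = 0) -> (forall i, B w (b i) = 0) -> B v w = 1 ->
  hyperbolic (fun i => if unlift ord0 i is Some j then a j else v)
             (fun i => if unlift ord0 i is Some j then b j else w).
Proof.
move=> [aa bb ab] va vb wa wb vw.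
split=> i j; case: (unliftP ord0 i) => [i'|] Ei; case: (unliftP ord0 j) => [j'|] Ej.
- exact: aa.
- by rewrite alt_anti va oppr0.
- exact: va.
- exact: alt.
- exact: bb.
- by rewrite alt_anti wb oppr0.
- exact: wb.
- exact: alt.
- by rewrite ab Ei Ej (inj_eq lift_inj).
- by rewrite alt_anti wa oppr0 Ei Ej eq_sym (negPf (neq_lift _ _)).
- by rewrite vb Ei Ej (negPf (neq_lift _ _)).
- by rewrite vw Ei Ej eqxx.
Qed.

(** A hyperbolic family in [W] whose residuals pair nontrivially with [W] can be
extended by a rescaled pair of residuals; since its members [a i] are
independent this stops, and then the residuals lie in the kernel of the form
on [W]. *)
Lemma hyperbolic_max (W : {vspace V}) :
  exists m (a b : 'I_m -> V),
    [/\ hyperbolic a b, forall i, a i \in W, forall i, b i \in W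
      & forall v w, v \in W -> w \in W -> B (residual a b v) w = 0].
Proof.
(* [k] bounds the number of extensions that remain possible. *)
suff: forall k m (a b : 'I_m -> V), hyperbolic a b -> (forall i, a i \in W) ->
    (forall i, b i \in W) -> (\dim {:V} < m + k)%N ->
  exists m (a b : 'I_m -> V),
    [/\ hyperbolic a b, forall i, a i \in W, forall i, b i \in W
      & forall v w, v \in W -> w \in W -> B (residual a b v) w = 0].
  move=> /(_ (\dim {:V}).+1 0 (fun=> 0) (fun=> 0)); apply; rewrite ?add0n //.
  - by split=> -[].
  - by case.
  - by case.
elim=> [|k IHk] m a b h aW bW mk.
  by move: (hyperbolic_leq h); rewrite leqNgt -[X in (_ < X)%N]addn0 mk.
have [done|] := pselect (forall v w, v \in W -> w \in W -> B (residual a b v) w = 0).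
  by exists m, a, b.
move=> /existsNP[v] /existsNP[w] /not_implyP[vW] /not_implyP[wW] /eqP nz.
pose v' := (B (residual a b v) w)^-1 *: residual a b v.
pose w' := residual a b w.
have resW u : u \in W -> residual a b u \in W.
  by move=> uW; rewrite rpredB // memv_hyp_comb.
apply: (IHk _ _ _ (hyperbolic_extend (v := v') (w := w') h _ _ _ _ _)).
- by move=> i; rewrite linearZ scale_lfunE residual_a // scaler0.
- by move=> i; rewrite linearZ scale_lfunE residual_b // scaler0.
- by move=> i; rewrite residual_a.
- by move=> i; rewrite residual_b.
- by rewrite linearZ scale_lfunE residualK //; apply: mulVf.
- by move=> i; case: unliftP => [j|] _; rewrite ?rpredZ ?resW.
- by move=> i; case: unliftP => [j|] _; rewrite ?resW.
- by rewrite addSnnS.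
Qed.

Lemma sum_rowP q (c : 'I_q -> V) k (x y : 'rV[F]_q) :
  \sum_i (k *: x + y) 0 i *: c i =
    k *: (\sum_i x 0 i *: c i) + \sum_i y 0 i *: c i.
Proof.
rewrite scaler_sumr -big_split; apply: eq_bigr => i _.
by rewrite !mxE scalerDl scalerA.
Qed.

(** Darboux normal form: [W] is the orthogonal sum of hyperbolic planes and of the
kernel [N] of the form on [W]. The normal form is given as a parametrization of
[W], because this is what an isomorphism from a Heisenberg algebra needs. *)
Lemma symplectic_coordinates (W N : {vspace V}) :
  (forall u, reflect (u \in W /\ forall c, c \in W -> B u c = 0) (u \in N)) ->
  exists m (psi : 'Hom((('rV[F]_m * 'rV[F]_m) * 'rV[F]_(\dim N))%type, V)),
    [/\ lker psi == 0%VS, limg psi = W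
      & forall u v, B (psi u) (psi v) =
          \sum_i (u.1.1 0 i * v.1.2 0 i - u.1.2 0 i * v.1.1 0 i)].
Proof.
move=> NP; have [m [a [b [h aW bW res0]]]] := hyperbolic_max W.
pose nul (u : ('rV[F]_m * 'rV[F]_m) * 'rV[F]_(\dim N)) :=
  \sum_(k < \dim N) u.2 0 k *: (vbasis N)`_k.
pose f (u : ('rV[F]_m * 'rV[F]_m) * 'rV[F]_(\dim N)) :=
  hyp_comb a b (u.1.1 0) (u.1.2 0) + nul u.
have fl : linear f.
  move=> k u v; rewrite /f /hyp_comb /nul /= !sum_rowP !scalerDr.
  by rewrite [RHS]addrACA; congr (_ + _); rewrite addrACA.
have nulN u : nul u \in N.
  by rewrite rpred_sum // => i _; rewrite rpredZ // vbasis_mem // mem_nth // size_tuple.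
have combW u v : hyp_comb a b u v \in W by exact: memv_hyp_comb.
have nulW u : nul u \in W by case: (NP _ (nulN u)).
have fW u : f u \in W by rewrite rpredD.
have nul0 u v : v \in W -> B (nul u) v = 0 by case: (NP _ (nulN u)) => _; apply.
have Bf u w : w \in W -> B (f u) w = B (hyp_comb a b (u.1.1 0) (u.1.2 0)) w.
  by move=> wW; rewrite linearD add_lfunE nul0 // addr0.
have Bfa u i : B (f u) (a i) = - u.1.2 0 i.
  by rewrite Bf // hyp_comb_a.
have Bfb u i : B (f u) (b i) = u.1.1 0 i.
  by rewrite Bf // hyp_comb_b.
have fE := linfunE_of fl.
exists m, (linfun f); split.
- rewrite -subv0; apply/subvP => u; rewrite memv_ker fE memv0 => /eqP fu0.
  have u11 i : u.1.1 0 i = 0 by rewrite -Bfb fu0 linear0 zero_lfunE.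
  have u12 i : u.1.2 0 i = 0.
    by apply/eqP; rewrite -oppr_eq0 -Bfa fu0 linear0 zero_lfunE.
  have nu0 : nul u = 0.
    rewrite -fu0 /f /hyp_comb !big1 ?add0r // => i _.
      by rewrite u12 scale0r.
    by rewrite u11 scale0r.
  have u2 := freeP (basis_free (vbasisP N)) _ nu0.
  apply/eqP; case: u u11 u12 u2 {fu0 nu0} => [[x y] z] /= hx hy hz.
  by congr (_, _, _); apply/rowP => i; rewrite !mxE.
- apply/vspaceP => v; apply/memv_imgP/idP => [[u _ ->]|vW]; first by rewrite fE.
  have rN : residual a b v \in N.
    apply/NP; split=> [|c cW]; last exact: res0.
    by rewrite rpredB.
  exists ((\row_i B v (b i), \row_i - B v (a i)),
          \row_i coord (vbasis N) i (residual a b v)).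
    exact: memvf.
  rewrite fE /f /nul /= [X in _ + X](_ : _ = residual a b v).
    rewrite /residual addrC [hyp_comb a b (_ 0) _](_ : _ =
      hyp_comb a b (fun i => B v (b i)) (fun i => - B v (a i))) ?subrK //.
    by rewrite /hyp_comb; congr (_ + _); apply: eq_bigr => i _; rewrite mxE.
  by rewrite [RHS](coord_vbasis rN); apply: eq_bigr => i _; rewrite mxE.
- move=> u v; rewrite !fE Bf //; move: (f v) (Bfa v) (Bfb v) => w wa wb.
  rewrite /hyp_comb linearD add_lfunE !form_suml -big_split.
  apply: eq_bigr => i _ /=.
  by rewrite (alt_anti (a i)) (alt_anti (b i)) wa wb opprK mulrN.
Qed.
End Symplectic.

Lemma bijective_lfun (F : fieldType) (U V : vectType F) (f : 'Hom(U, V)) :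
  lker f == 0%VS -> limg f = fullv -> bijective f.
Proof.
move=> kf imf; exists (f^-1)%VF; first exact: lker0_lfunK.
by move=> v; apply: limg_lfunVK; rewrite imf memvf.
Qed.

(** * Splitting off an ideal of codimension one *)

Section LieSplit.
Variables (F : fieldType) (V K : vectType F).
Variables (br : V -> V -> V) (kbr : K -> K -> K) (phi : 'Hom((F^o * K)%type, V)).
Hypotheses (br_lie : is_lie_bracket br) (phi_bij : bijective phi).
Hypothesis phi_kbr : forall x y, phi (0, kbr x y) = br (phi (0, x)) (phi (0, y)).
Hypothesis phi_ideal :
  forall x, exists y, br (phi (1, 0)) (phi (0, x)) = phi (0, y).

Lemma lie_anti u v : br u v = - br v u.
Proof.
have [brl brr alt _] := br_lie.
apply/eqP; rewrite -addr_eq0; apply/eqP.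
have := alt (u + v).
have D x y z : br x (y + z) = br x y + br x z by rewrite -[y]scale1r brl !scale1r.
have D' x y z : br (y + z) x = br y x + br z x by rewrite -[y]scale1r brr !scale1r.
by rewrite D !D' !alt add0r addr0 addrC.
Qed.

(** A line is a Lie subalgebra, so a linear complement of a codimension-one ideal
already gives a semidirect product, and the action is the adjoint action of
[phi (1, 0)]; it acts by derivations by the Jacobi identity. *)
Lemma lie_split_sdprod :
  exists rho : 'Hom(F^o, 'End(K)),
    is_lie_action (@abelian_br F F^o) kbr rho /\
    lie_iso (sdprod_br (@abelian_br F F^o) kbr rho) br phi.
Proof.
have [brl brr alt jac] := br_lie; have [psi phiK psiK] := phi_bij.
have phi_inj := can_inj phiK.
pose e := phi (1, 0).
pose g x := (psi (br e (phi (0, x)))).2.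
have gP x : phi (0, g x) = br e (phi (0, x)).
  by rewrite /g; case: (phi_ideal x) => y ->; rewrite phiK.
have inj0 x y : phi (0, x) = phi (0, y) -> x = y by move/phi_inj => [].
have phiP k x y : phi (0, k *: x + y) = k *: phi (0, x) + phi (0, y).
  rewrite -linearZ -linearD /=; congr (phi _); congr (_, _).
  by rewrite /= scaler0 addr0.
have gl : linear g.
  by move=> k x y; apply: inj0; rewrite phiP !gP phiP brl.
have gE := linfunE_of gl.
pose rho0 (t : F^o) : 'End(K) := t *: linfun g.
have rhol : linear rho0.
  by move=> k s t; rewrite /rho0 scalerDl scalerA.
pose rho := linfun rho0; have rhoE t x : rho t x = t *: g x.
  by rewrite /rho linfunE_of // scale_lfunE gE.
have phiS t x : phi (t, x) = t *: e + phi (0, x).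
  rewrite -linearZ -linearD /=; congr (phi _); congr (_, _).
    by rewrite /= addr0; exact: (esym (mulr1 t)).
  by rewrite /= scaler0 add0r.
have phi0 : phi (0, 0) = 0 by rewrite -[(0, 0)]/(0 : F^o * K) linear0.
have phi0Z k x : phi (0, k *: x) = k *: phi (0, x).
  by have := phiP k x 0; rewrite phi0 !addr0.
have phi0D x y : phi (0, x + y) = phi (0, x) + phi (0, y).
  by have := phiP 1 x y; rewrite !scale1r.
have phi0N x : phi (0, - x) = - phi (0, x) by rewrite -scaleN1r phi0Z scaleN1r.
have brDr x y z : br x (y + z) = br x y + br x z.
  by rewrite -[y]scale1r brl !scale1r.
have brDl x y z : br (y + z) x = br y x + br z x.
  by rewrite -[y]scale1r brr !scale1r.
have br0r x : br x 0 = 0 by apply: (addrI (br x 0)); rewrite -brDr !addr0.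
have br0l x : br 0 x = 0 by apply: (addrI (br 0 x)); rewrite -brDl !addr0.
have brZr k x y : br x (k *: y) = k *: br x y.
  by rewrite -[k *: y]addr0 brl br0r addr0.
have brZl k x y : br (k *: x) y = k *: br x y.
  by rewrite -[k *: x]addr0 brr br0l addr0.
exists rho; split; last first.
  split=> // -[s x] [t y]; rewrite /sdprod_br /= phiS (phiS s x) (phiS t y).
  rewrite !phi0D phi0N !rhoE !phi0Z.
  rewrite !gP phi_kbr /abelian_br scale0r add0r !brDr !brDl !brZr !brZl alt !scaler0.
  rewrite add0r (lie_anti (phi (0, x)) e) scalerN.
  by rewrite [LHS]addrC; congr (_ + _); rewrite addrC.
split=> [t x y|s t]; last first.
  apply/lfunP => x; rewrite /abelian_br linear0 zero_lfunE add_lfunE opp_lfunE !comp_lfunE.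
  have gZ k z : g (k *: z) = k *: g z by rewrite -gE linearZ /= gE.
  by rewrite !rhoE !gZ !scalerA mulrC subrr.
apply: inj0; rewrite !rhoE phi0D !phi_kbr !phi0Z !gP phi_kbr brZl brZr -scalerDr.
congr (_ *: _); have := jac e (phi (0, x)) (phi (0, y)).
rewrite (lie_anti (phi (0, x)) (br (phi (0, y)) e)) (lie_anti (phi (0, y)) e).
rewrite (lie_anti (phi (0, y)) (br _ _)).
have brN u v : br u (- v) = - br u v by rewrite -scaleN1r brZr scaleN1r.
have brNl u v : br (- u) v = - br u v by rewrite -scaleN1r brZl scaleN1r.
rewrite brNl opprK => /eqP; rewrite -addrA addr_eq0 => /eqP ->.
by rewrite (lie_anti (br e (phi (0, y)))) opprD !opprK addrC.
Qed.
End LieSplit.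

(** * Traces *)

Section Trace.
Variables (F : fieldType) (V : vectType F) (I : finType).

(** The trace as the image of [\sum_i c i \otimes f (b i)], for any decomposition
[\sum_i c i \otimes b i] of the identity. *)
Lemma lfun_traceE (b : I -> V) (c : I -> V -> F) (f : 'End(V)) :
  (forall i, linear (c i : V -> F^o)) ->
  (forall v, v = \sum_i c i v *: b i) -> lfun_trace f = \sum_i c i (f (b i)).
Proof.
move=> cl cE; pose cL i := linfun (c i : V -> F^o).
have cLE i v : cL i v = c i v by rewrite /cL linfunE_of.
rewrite /lfun_trace /mxtrace.
transitivity (\sum_(i < \dim {:V}) \sum_j c j (vbasis {:V})`_i * coord (vbasis {:V}) i (f (b j))).
  apply: eq_bigr => i _; rewrite /passmx.mxof /lin1_mx !mxE /= passmx.vecof_delta.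
  rewrite [X in f X]cE !linear_sum; apply: eq_bigr => j _ /=.
  by rewrite !linearZ.
rewrite exchange_big; apply: eq_bigr => j _ /=.
rewrite [in RHS](coord_vbasis (memvf (f (b j)))) -cLE linear_sum.
by apply: eq_bigr => i _; rewrite linearZ /= cLE mulrC.
Qed.
End Trace.

(** * The dual of the oscillator algebra *)

Section OscDual.
Variables (R : realType) (n : nat).
Implicit Types (u v : osc R n) (a b : dual (osc R n)).

Definition osc_dual_basis (k : bool + ('I_n + 'I_n)) : dual (osc R n) :=
  match k with
  | inl true => em1_dual | inl false => e0_dual
  | inr (inl i) => ei_dual i | inr (inr i) => ec_dual i
  end.

Definition osc_basis (k : bool + ('I_n + 'I_n)) : osc R n :=
  match k with
  | inl true => em1 | inl false => e0
  | inr (inl i) => ei i | inr (inr i) => ec i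
  end.

Lemma osc_dual_ext a b :
  (forall k, a (osc_basis k) = b (osc_basis k)) -> a = b.
Proof.
move=> ab; apply/lfunP => u.
have -> : u = u.1.1 *: em1 + u.1.2 *: e0 +
      (\sum_i u.2.1 0 i *: ei i + \sum_i u.2.2 0 i *: ec i).
  case: u => [[s t] [x y]] /=.
  have ->: \sum_i x 0 i *: ei i = (0, (x, 0)) :> osc R n.
    have l : linear (fun x : 'rV[R]_n => (0, (x, 0)) : osc R n).
      by move=> k y1 y2; apply: osc_eqP => [||i|i] //=; rewrite ?scaler0 ?addr0 // !mxE mulr0 addr0.
    rewrite {2}(row_sum_delta x) -(linfunE_of l) linear_sum.
    by apply: eq_bigr => i _; rewrite linearZ /= linfunE_of.
  have ->: \sum_i y 0 i *: ec i = (0, (0, y)) :> osc R n.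
    have l : linear (fun x : 'rV[R]_n => (0, (0, x)) : osc R n).
      by move=> k y1 y2; apply: osc_eqP => [||i|i] //=; rewrite ?scaler0 ?addr0 // !mxE mulr0 addr0.
    rewrite {2}(row_sum_delta y) -(linfunE_of l) linear_sum.
    by apply: eq_bigr => i _; rewrite linearZ /= linfunE_of.
  apply: osc_eqP => [||i|i] /=; rewrite ?scaler0 ?addr0 ?add0r ?mxE ?mulr0 ?add0r ?addr0 //.
    by rewrite /GRing.scale /= mulr1.
  by rewrite /GRing.scale /= mulr1.
rewrite !linearD !linearZ /= (ab (inl true)) (ab (inl false)) !linear_sum.
congr (_ + (_ + _)); apply: eq_bigr => i _; rewrite !linearZ /=.
  by rewrite (ab (inr (inl i))).
by rewrite (ab (inr (inr i))).
Qed.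

Lemma sum_osc_index (T : nmodType) (f : bool + ('I_n + 'I_n) -> T) :
  \sum_k f k = f (inl true) + f (inl false)
    + (\sum_i f (inr (inl i)) + \sum_i f (inr (inr i))).
Proof. by rewrite big_sumType big_bool big_sumType. Qed.

Lemma osc_dual_pairing k l : osc_dual_basis k (osc_basis l) = (k == l)%:R.
Proof.
case: k => [[]|[i|i]]; case: l => [[]|[j|j]] /=;
  rewrite ?em1_dualE ?e0_dualE ?ei_dualE ?ec_dualE /= ?mxE //.
Qed.

Lemma osc_dual_expand a : a = \sum_k a (osc_basis k) *: osc_dual_basis k.
Proof.
have E l : (\sum_k a (osc_basis k) *: osc_dual_basis k) (osc_basis l) = a (osc_basis l).
  rewrite sum_lfunE -[RHS](sum_delta l (fun k => a (osc_basis k))).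
  by apply: eq_bigr => k _; rewrite scale_lfunE osc_dual_pairing.
by apply: osc_dual_ext => l; rewrite E.
Qed.

Lemma osc_dual_trace (f : 'End(dual (osc R n))) :
  lfun_trace f = \sum_k f (osc_dual_basis k) (osc_basis k).
Proof.
apply: (lfun_traceE (c := fun k a => a (osc_basis k))) => [k|]; last exact: osc_dual_expand.
by move=> s a b; rewrite add_lfunE scale_lfunE.
Qed.

Lemma dim_oscSd : \dim (oscSd : {vspace dual (osc R n)}) = (n + n)%N.
Proof.
have fl : linear (fun a => (a em1, a e0) : (R^o * R^o)%type).
  by move=> k a b; rewrite !add_lfunE !scale_lfunE.
pose f := linfun (fun a : dual (osc R n) => (a em1, a e0) : (R^o * R^o)%type).
have fE : f =1 _ := linfunE_of fl.
have kerf : lker f = oscSd.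
  apply/vspaceP => a; rewrite memv_ker fE; apply/eqP/mem_oscSd => [[-> ->] //|[-> ->] //].
have imf : limg f = fullv.
  apply/vspaceP => -[s t]; rewrite memvf; apply/memv_imgP.
  exists (s *: em1_dual + t *: e0_dual); first exact: memvf.
  rewrite fE !add_lfunE !scale_lfunE !em1_dualE !e0_dualE /=.
  by rewrite /GRing.scale /= !mulr1 !mulr0 addr0 add0r.
have := limg_ker_dim f fullv; rewrite capfv kerf imf !dimvf.
rewrite -[RHS]/((1 + 1 + (1 * n + 1 * n)) * 1)%N muln1 !mul1n => /eqP.
by rewrite [X in _ == X]addnC eqn_add2r => /eqP.
Qed.

End OscDual.

(** * The adjoint and coadjoint actions of the oscillator algebra *)

Section OscLie.
Variables (R : realType) (n : nat) (lam : 'I_n -> R).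
Implicit Types (u v : osc R n) (a b : dual (osc R n)).
Local Notation ad := (ad (osc_br lam)).

Lemma osc_adE u v : ad u v = osc_br lam u v.
Proof. exact: adE (osc_br_lie lam) u v. Qed.

Lemma omega_em1l v : omega em1 v = 0.
Proof. by apply: big1 => i _; rewrite !mxE !mul0r subrr. Qed.

Lemma osc_br_split u v :
  osc_br lam u v = u.1.1 *: osc_br lam em1 v - v.1.1 *: osc_br lam em1 u
                   + omega u v *: e0.
Proof.
apply: osc_eqP => [||i|i] /=; rewrite ?mxE /= ?mxE /=.
- by rewrite !scaler0 oppr0 !addr0.
- have := omega_em1l v; have := omega_em1l u; rewrite /omega /= => -> ->.
  by rewrite !scaler0 subrr add0r /GRing.scale /= mulr1.
- by ring.
- by ring.
Qed.

Lemma omega_anti u v : omega u v = - omega v u.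
Proof. by rewrite /omega -sumrN; apply: eq_bigr => i _; ring. Qed.

(** Modulo [em1_dual] and the forms [iomega u], every coadjoint operator is a
multiple of that of [em1]. As [r] kills [em1_dual], only [em1] contributes to
[dagger (ad u) r] on forms that vanish at [e0]. *)
Lemma lstar_ad u a :
  lstar (ad u) a = u.1.1 *: lstar (ad em1) a - a (osc_br lam em1 u) *: em1_dual
                   + a e0 *: iomega u.
Proof.
apply/lfunP => v; rewrite !add_lfunE opp_lfunE !scale_lfunE !lstarE !osc_adE.
rewrite osc_br_split !linearD linearN !linearZ /= em1_dualE iomegaE.
by rewrite /GRing.scale /=; ring.
Qed.

Lemma lstar_ad_em1_dual u : lstar (ad u) em1_dual = 0.
Proof.
by apply/lfunP => v; rewrite lstarE osc_adE em1_dualE zero_lfunE.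
Qed.

Lemma lstar_ad_em1_e0_dual : lstar (ad em1) e0_dual = 0.
Proof.
apply/lfunP => v; rewrite lstarE osc_adE e0_dualE zero_lfunE.
exact: omega_em1l.
Qed.

Lemma omega_eil i v : omega (ei i) v = v.2.2 0 i.
Proof.
rewrite /omega (bigD1 i) //= big1 => [|j /negPf ji]; rewrite !mxE ?eqxx ?ji /=.
  by rewrite mul1r mul0r subr0 addr0.
by rewrite !mul0r subr0.
Qed.

Lemma omega_ecl i v : omega (ec i) v = - v.2.1 0 i.
Proof.
rewrite /omega (bigD1 i) //= big1 => [|j /negPf ji]; rewrite !mxE ?eqxx ?ji /=.
  by rewrite mul1r mul0r add0r addr0.
by rewrite !mul0r subr0.
Qed.

Lemma omega_e0l v : omega e0 v = 0.
Proof. by apply: big1 => i _; rewrite !mxE !mul0r subrr. Qed.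

Lemma oscS_em1 u : u \in oscS -> u.1.1 = 0.
Proof.
suff: (oscS <= lker (em1_dual : dual (osc R n)))%VS.
  by move=> /subvP h /h; rewrite memv_ker em1_dualE => /eqP.
rewrite subv_add; apply/andP; split; apply/span_subvP => _ /mapP[i _ ->];
  by rewrite memv_ker em1_dualE.
Qed.

Lemma osc_im_ad_em1 u : (forall i, lam i != 0) ->
  exists v, u = u.1.1 *: em1 + u.1.2 *: e0 + osc_br lam em1 v.
Proof.
move=> lam0; exists ((0, 0), (\row_i (u.2.2 0 i / lam i), \row_i (- u.2.1 0 i / lam i))).
apply: osc_eqP => [||i|i] /=; rewrite ?mxE /= ?mxE /= ?scaler0 ?addr0 ?add0r.
- by rewrite /GRing.scale /= mulr1.
- rewrite big1 => [|i _]; last by rewrite !mxE !mul0r subrr.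
  by rewrite addr0 /GRing.scale /= mulr1.
- by field; apply: lam0.
- by field; apply: lam0.
Qed.

(** [J] commutes with [ad em1], hence preserves its image, which has no component
along [em1]; this image together with [em1] and [e0], both killed by [J], spans. *)
Lemma commuting_em1_coord (J : 'End(osc R n)) u : (forall i, lam i != 0) ->
  (J \o ad em1)%VF = (ad em1 \o J)%VF -> J em1 = 0 -> J e0 = 0 ->
  (J u).1.1 = 0.
Proof.
move=> lam0 Jc J1 J0; have [v ->] := osc_im_ad_em1 u lam0.
rewrite !linearD !linearZ /= J1 J0 -osc_adE -(comp_lfunE J) Jc comp_lfunE osc_adE /=.
by rewrite !scaler0 !add0r.
Qed.

(** Apply [J] to [[ei i, ec i] = e0]: a derivation that kills [e0] is infinitesimally
symplectic, so its trace vanishes already on each plane spanned by [ei i], [ec i]. *)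
Lemma derivation_trace_pair (J : 'End(osc R n)) i :
  is_derivation (osc_br lam) J -> J e0 = 0 -> (forall u, (J u).1.1 = 0) ->
  (J (ei i)).2.1 0 i + (J (ec i)).2.2 0 i = 0.
Proof.
move=> Jd J0 J1; have := Jd (ei i) (ec i).
rewrite osc_br_ei_ec eqxx scale1r J0 osc_br_split [X in _ + X]osc_br_split.
rewrite !J1 !scale0r !subr0 !add0r omega_eil omega_anti omega_ecl opprK -scalerDl.
move=> /(congr1 (fun w : osc R n => w.1.2)) /=.
by rewrite /GRing.scale /= mulr1 => <-.
Qed.

(** * The dual bracket *)

Section Cobracket.
Variables (r : dform (osc R n)) (u0 : osc R n) (J : 'End(osc R n)).
Variable xi : 'Hom(osc R n, dform (osc R n)).
Hypotheses (r_S : wedge2S r) (u0_S : u0.1.1 = 0).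
Hypotheses (J_der : is_derivation (osc_br lam) J) (J_e0 : J e0 = 0).
Hypothesis J_coord : forall u, (J u).1.1 = 0.
Hypothesis xi_def : forall u, xi u = dagger (ad u) r + 2 *: wedge e0 ((J + ad u0) u).

Local Notation B := (dagger (ad em1) r).
Local Notation dbr := (dual_br xi).

(** The adjoint action of [e0_dual] on the ideal of forms that vanish at [e0];
see [dual_br_e0]. *)
Definition e0_act a : dual (osc R n) :=
  iomega (sharp r a) + 2 *: lstar (J + ad u0) a.

Lemma r_skew a b : r a b = - r b a. Proof. by case: r_S. Qed.

Lemma r_em1l b : r em1_dual b = 0.
Proof. by rewrite -sharpE; case: r_S => _ -> _; rewrite linear0. Qed.

Lemma r_e0l b : r e0_dual b = 0.
Proof. by rewrite -sharpE; case: r_S => _ _ ->; rewrite linear0. Qed.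

Lemma r_em1r b : r b em1_dual = 0. Proof. by rewrite r_skew r_em1l oppr0. Qed.

Lemma r_iomega a u : r a (iomega u) = - iomega (sharp r a) u.
Proof. by rewrite -sharpE !iomegaE omega_anti. Qed.

Lemma r_lstar_ad u a b : r (lstar (ad u) a) b =
  u.1.1 * r (lstar (ad em1) a) b + a e0 * iomega (sharp r b) u.
Proof.
rewrite lstar_ad linearD add_lfunE linearB add_lfunE opp_lfunE !linearZ !scale_lfunE /=.
by rewrite r_em1l scaler0 subr0 (r_skew (iomega u)) r_iomega opprK.
Qed.

Lemma e0_actS a u :
  e0_act a u = iomega (sharp r a) u + 2 * a ((J + ad u0) u).
Proof. by rewrite [LHS]add_lfunE scale_lfunE lstarE. Qed.

Lemma dagger_ad u a b : dagger (ad u) r a b =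
  u.1.1 * B a b + a e0 * iomega (sharp r b) u - b e0 * iomega (sharp r a) u.
Proof.
rewrite !daggerE (r_skew a (lstar (ad u) b)) (r_skew a (lstar (ad em1) b)).
by rewrite !(r_lstar_ad u) mulrBr opprD addrACA addrA.
Qed.

(** The whole structure of the dual algebra: on forms that vanish at [e0] the bracket
is the alternating form [B] with values in the line of [em1_dual], and [e0_dual] acts
by [e0_act]. *)
Lemma dual_brS a b :
  dbr a b = B a b *: em1_dual + a e0 *: e0_act b - b e0 *: e0_act a.
Proof.
apply/lfunP => u; have outE c := e0_actS c u.
rewrite dual_brE; move: ((J + ad u0) u) (xi_def u) outE => w -> outE.
rewrite 2!add_lfunE (dagger_ad u) 2!scale_lfunE wedgeE.
rewrite 2!add_lfunE opp_lfunE 3!scale_lfunE em1_dualE !outE.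
have dist (t c p q x y z w' : R) : t * c + p * x - q * y + 2 * (p * z - w' * q) =
  c * t + p * (x + 2 * z) - q * (y + 2 * w') by ring.
exact: dist.
Qed.

Lemma dform_alt_em1 a : B a a = 0.
Proof. by rewrite daggerE r_skew addNr. Qed.

Lemma dform_em1_em1l a : B em1_dual a = 0.
Proof. by rewrite daggerE lstar_ad_em1_dual r_em1l linear0 zero_lfunE addr0. Qed.

Lemma dform_em1_em1r a : B a em1_dual = 0.
Proof. by rewrite daggerE lstar_ad_em1_dual r_em1r linear0 addr0. Qed.

Lemma dform_em1_mod s t a b : B (s *: em1_dual + a) (t *: em1_dual + b) = B a b.
Proof.
have -> : B (s *: em1_dual + a) = s *: B em1_dual + B a by exact: linearP.
rewrite add_lfunE scale_lfunE dform_em1_em1l scaler0 add0r.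
by rewrite linearP /= dform_em1_em1r scaler0 add0r.
Qed.

Lemma dform_em1_e0l a : B e0_dual a = 0.
Proof. by rewrite daggerE lstar_ad_em1_e0_dual r_e0l linear0 zero_lfunE addr0. Qed.

Lemma e0_act_em1 : e0_act em1_dual = 0.
Proof.
apply/lfunP => u; rewrite e0_actS iomegaE zero_lfunE.
have [_ -> _] := r_S.
rewrite [omega _ _]big1 => [|i _]; last by rewrite !mxE !mul0r subrr.
by rewrite add_lfunE osc_adE em1_dualE /= J_coord add0r addr0 mulr0.
Qed.

Lemma e0_act_e0_coord a : e0_act a e0 = 0.
Proof.
rewrite e0_actS iomegaE omega_anti omega_e0l oppr0 add0r.
rewrite add_lfunE J_e0 add0r osc_adE.
by rewrite osc_br_split u0_S omega_anti omega_e0l oppr0 !scale0r subr0 addr0 linear0 mulr0.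
Qed.

Lemma dual_br_em1 a : dbr em1_dual a = 0.
Proof.
rewrite dual_brS dform_em1_em1l e0_act_em1 em1_dualE.
by rewrite !scale0r scaler0 add0r subr0.
Qed.

Lemma dual_br_em1r a : dbr a em1_dual = 0.
Proof.
rewrite dual_brS e0_act_em1 em1_dualE !scale0r scaler0 subr0 addr0.
by rewrite dform_em1_em1r scale0r.
Qed.

Lemma dual_br_e0 a : a e0 = 0 -> dbr e0_dual a = e0_act a.
Proof.
by move=> a0; rewrite dual_brS dform_em1_e0l a0 !scale0r e0_dualE scale1r add0r subr0.
Qed.

Lemma e0_actE a : a \in oscSd ->
  e0_act a = 2 *: lstar J a - (2 * lstar (ad em1) a u0) *: em1_dual
                + iomega (sharp r a).
Proof.
move=> /mem_oscSd[_ a0]; rewrite /e0_act addrC; congr (_ + _).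
rewrite -scalerA -scalerBr; congr (_ *: _).
apply/lfunP => u; rewrite !(add_lfunE, opp_lfunE, scale_lfunE) !lstarE add_lfunE linearD /=.
congr (_ + _); rewrite -lstarE lstar_ad u0_S a0 !scale0r add0r addr0.
by rewrite opp_lfunE scale_lfunE osc_adE.
Qed.

Lemma dual_br_e0_coord a b : dbr a b e0 = 0.
Proof.
rewrite dual_brS !add_lfunE opp_lfunE !scale_lfunE !e0_act_e0_coord em1_dualE.
by rewrite !scaler0 subr0 addr0.
Qed.

(** The contributions of [J] and of [ad u0] to the trace vanish; in each plane the
two diagonal entries of [iomega \o sharp r] both equal [- r (ei_dual i) (ec_dual i)]. *)
Lemma e0_act_trace :
  \sum_i e0_act (ei_dual i) (ei i) + \sum_i e0_act (ec_dual i) (ec i) =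
    - 2 * \sum_i r (ei_dual i) (ec_dual i).
Proof.
rewrite mulr_sumr -big_split; apply: eq_bigr => i _ /=.
have Jad w : w.1.1 = 0 -> ((J + ad u0) w).2 = (J w).2.
  move=> w0; rewrite add_lfunE osc_adE osc_br_split u0_S w0 !scale0r subr0 add0r /=.
  by rewrite scaler0 addr0.
have -> : e0_act (ei_dual i) (ei i)
    = - r (ei_dual i) (ec_dual i) + 2 * (J (ei i)).2.1 0 i.
  rewrite e0_actS; congr (_ + 2 * _); last by rewrite ei_dualE Jad.
  by rewrite iomegaE omega_anti omega_eil -ec_dualE sharpE.
have -> : e0_act (ec_dual i) (ec i)
    = - r (ei_dual i) (ec_dual i) + 2 * (J (ec i)).2.2 0 i.
  rewrite e0_actS; congr (_ + 2 * _); last by rewrite ec_dualE Jad.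
  by rewrite iomegaE omega_anti omega_ecl opprK -ei_dualE sharpE r_skew.
have alg (s t q : R) : s + t = 0 -> - q + 2 * s + (- q + 2 * t) = - 2 * q.
  by move=> /eqP; rewrite addr_eq0 => /eqP ->; ring.
exact: alg (derivation_trace_pair i J_der J_e0 J_coord).
Qed.

(** Forms that vanish at [e0] act nilpotently, so only the [e0_dual]-component of
[a] contributes. *)
Lemma dual_br_trace a :
  lfun_trace (Defs.ad dbr a) = a e0 * (- 2 * \sum_i r (ei_dual i) (ec_dual i)).
Proof.
have dl : linear (dbr a).
  move=> k b c; apply/lfunP => u.
  by rewrite !(dual_brE, add_lfunE, scale_lfunE, linearP).
rewrite osc_dual_trace sum_osc_index /Defs.ad !(linfunE_of dl) /=.
rewrite dual_br_em1r zero_lfunE dual_br_e0_coord !add0r -e0_act_trace mulrDr !mulr_sumr.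
congr (_ + _); apply: eq_bigr => i _; rewrite (linfunE_of dl) dual_brS.
  rewrite ei_dualE /= mxE scale0r subr0 add_lfunE !scale_lfunE em1_dualE /= scaler0 add0r //.
by rewrite ec_dualE /= mxE scale0r subr0 add_lfunE !scale_lfunE em1_dualE /= scaler0 add0r.
Qed.

Lemma dual_br_unimodular :
  unimodular dbr <-> \sum_i r (ei_dual i) (ec_dual i) = 0.
Proof.
split=> [h|h a]; last by rewrite dual_br_trace h !mulr0.
have := h e0_dual; rewrite dual_br_trace e0_dualE mul1r => /eqP.
by rewrite mulf_eq0 oppr_eq0 pnatr_eq0 => /eqP.
Qed.

(** The derived series descends into the forms that vanish at [e0], then into the line
of [em1_dual], which is central. *)
Lemma dual_br_solvable : lie_solvable dbr.
Proof.
have e0l : linear (fun a => a e0 : R^o).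
  by move=> k a b; rewrite add_lfunE scale_lfunE.
pose K := lker (linfun (fun a : dual (osc R n) => a e0)).
have KP a : a \in K -> a e0 = 0 by rewrite memv_ker (linfunE_of e0l) => /eqP.
have D1 : (derived_series dbr 1 <= K)%VS.
  by apply: lie_comm_min => a b _ _; rewrite memv_ker (linfunE_of e0l) dual_br_e0_coord.
have D2 : (derived_series dbr 2 <= <[em1_dual]>)%VS.
  apply: lie_comm_min => a b /(subvP D1)/KP a0 /(subvP D1)/KP b0.
  by rewrite dual_brS a0 b0 !scale0r subr0 addr0 memvZ ?memv_line.
exists 3; apply/eqP; rewrite -subv0; apply: lie_comm_min => a b.
move=> /(subvP D2)/vlineP[s ->] _; rewrite memv0; apply/eqP/lfunP => u.
by rewrite dual_brE linearZ scale_lfunE -dual_brE dual_br_em1 zero_lfunE scaler0.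
Qed.

(** Symplectic coordinates for [B] on [oscSd], completed by [em1_dual] and [e0_dual],
are coordinates on the dual in which the ideal of forms that vanish at [e0] is a
Heisenberg algebra plus the kernel of [B]. Counting dimensions in them shows that
this kernel has dimension [2p]. *)
Lemma dual_br_sdprod : is_lie_bracket dbr ->
  exists p : nat,
   [/\ (p <= n)%N,
     \dim (radical oscSd B) = (2 * p)%N
   & exists (rho : 'Hom(R^o, 'End((heis R (n - p) * 'rV[R]_(2 * p))%type)))
            (phi : 'Hom((R^o * (heis R (n - p) * 'rV[R]_(2 * p)))%type,
                               dual (osc R n))),
              let h_br := prod_br (@heis_br R (n - p))
                                  (@abelian_br R 'rV[R]_(2 * p)) in
              [/\ is_lie_action (@abelian_br R R^o) h_br rho,
                  lie_iso (sdprod_br (@abelian_br R R^o) h_br rho)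
                          dbr phi,
                  phi (1, 0) = e0_dual
                & forall a, a \in (<[em1_dual]> + oscSd)%VS <->
                            exists x, a = phi (0, x)]].
Proof.
move=> dbr_lie; pose N := radical oscSd B.
have [m [psi [kpsi impsi Bpsi]]] := symplectic_coordinates
  dform_alt_em1 (mem_radical oscSd B).
rewrite -/N in psi kpsi impsi Bpsi *.
have dimN : (n + n = m + m + \dim N)%N.
  rewrite -(dim_oscSd R) -impsi limg_dim_eq; last by rewrite (eqP kpsi) capv0.
  rewrite dimvf -[LHS]/(1 * m + 1 * m + 1 * \dim N)%N !mul1n //.
have [p pn mE] : exists2 p, (p <= n)%N & m = (n - p)%N.
  have mn : (m <= n)%N by rewrite -leq_double -!addnn dimN leq_addr.
  by exists (n - m)%N; rewrite ?leq_subr ?subKn.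
have Np : \dim N = (2 * p)%N.
  have : (m + m + \dim N = m + m + 2 * p)%N.
    by rewrite -dimN mE mul2n -addnn addnACA subnK.
  by move/addnI.
(* The Heisenberg factor of rank [m] is needed as [heis R (n - p)]. *)
exists p; split=> //; subst m.
move: psi kpsi impsi Bpsi; rewrite Np => psi kpsi impsi Bpsi.
set K := (heis R (n - p) * 'rV[R]_(2 * p))%type.
pose f (u : R^o * K) := u.1 *: e0_dual + (u.2.1.1 *: em1_dual + psi (u.2.1.2, u.2.2)).
have fl : linear f.
  move=> k u v; rewrite /f /= !scalerDl !scalerDr -!scalerA.
  rewrite [RHS]addrACA; congr (_ + _); rewrite [RHS]addrACA; congr (_ + _).
  exact: (linearP psi k (u.2.1.2,u.2.2) (v.2.1.2,v.2.2)).
pose phi := linfun f; have phiE : phi =1 f := linfunE_of fl.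
have psiS x : psi x \in oscSd by rewrite -impsi memv_img ?memvf.
have psi_em1 x : psi x em1 = 0 by case/mem_oscSd: (psiS x).
have psi_e0 x : psi x e0 = 0 by case/mem_oscSd: (psiS x).
have f_e0 (u : R^o * K) : f u e0 = u.1.
  rewrite !add_lfunE !scale_lfunE e0_dualE em1_dualE psi_e0 /= scaler0 !addr0.
  exact: mulr1.
have f_em1 (u : R^o * K) : f u em1 = u.2.1.1.
  rewrite !add_lfunE !scale_lfunE e0_dualE em1_dualE psi_em1 /= scaler0 add0r addr0.
  exact: mulr1.
have kphi : lker phi == 0%VS.
  apply/lker0P => u v; rewrite !phiE => fuv.
  have u1 : u.1 = v.1 by rewrite -!f_e0 fuv.
  have u2 : u.2.1.1 = v.2.1.1 by rewrite -!f_em1 fuv.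
  move: fuv; rewrite /f u1 u2 => /addrI/addrI/(lker0P kpsi).
  case: u v u1 u2 => [s [[z xy] w]] [s' [[z' xy'] w']] /= -> -> [-> ->] //.
have img0 (a : dual (osc R n)) : a e0 = 0 -> exists x, a = phi (0, x).
  move=> a0; have : a - a em1 *: em1_dual \in limg psi.
    rewrite impsi; apply/mem_oscSd.
    rewrite !add_lfunE !opp_lfunE !scale_lfunE !em1_dualE a0 !scaler0 subr0.
    by split=> //; rewrite /GRing.scale /= mulr1 subrr.
  case/memv_imgP => -[xy w] _ aE.
  exists ((a em1, xy), w); rewrite phiE /f /= scale0r add0r -aE.
  by rewrite addrC subrK.
have phi10 : phi (1, 0) = e0_dual.
  rewrite phiE /f /= scale1r scale0r add0r.
  by rewrite -[(_, _)]/(0 : ('rV[R]_(n-p) * 'rV[R]_(n-p)) * 'rV[R]_(2 * p)) linear0 addr0.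
have phi_e0 x : phi (0, x) e0 = 0 by rewrite phiE f_e0.
have imphi : limg phi = fullv.
  apply/vspaceP => a; rewrite memvf; apply/memv_imgP.
  have [|x ax] := img0 (a - a e0 *: e0_dual).
    rewrite add_lfunE opp_lfunE scale_lfunE e0_dualE /=.
    by rewrite /GRing.scale /= mulr1 subrr.
  exists ((a e0, 0) + (0, x)); first exact: memvf.
  have -> : phi ((a e0, 0) + (0, x)) = phi (a e0, 0) + phi (0, x) by exact: linearD.
  rewrite -ax phiE /f /= scale0r add0r.
  rewrite -[(_, _)]/(0 : ('rV[R]_(n-p) * 'rV[R]_(n-p)) * 'rV[R]_(2 * p)) linear0 addr0.
  by rewrite addrC subrK.
have phi_bij := bijective_lfun kphi imphi.
have phi_kbr x y : phi (0, prod_br (@heis_br R (n - p)) (@abelian_br R 'rV[R]_(2 * p)) x y)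
    = dbr (phi (0, x)) (phi (0, y)).
  rewrite dual_brS !phi_e0 !scale0r subr0 addr0.
  rewrite !phiE /f /= !scale0r !add0r.
  rewrite -[(_, _)]/(0 : ('rV[R]_(n-p) * 'rV[R]_(n-p)) * 'rV[R]_(2 * p)) linear0 addr0.
  by congr (_ *: _); rewrite dform_em1_mod Bpsi.
have phi_ideal x : exists y, dbr (phi (1, 0)) (phi (0, x)) = phi (0, y).
  by apply: img0; rewrite dual_br_e0_coord.
have [rho [rho_act rho_iso]] := lie_split_sdprod dbr_lie phi_bij phi_kbr phi_ideal.
exists rho, phi; split=> // a; split=> [/memv_addP[b /vlineP[s ->] [c cS ->]]|[x ->]].
  apply: img0; have [_ c0] := mem_oscSd _ cS.
  by rewrite add_lfunE scale_lfunE em1_dualE c0 scaler0 addr0.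
by rewrite phiE /f /= scale0r add0r memv_add ?memvZ ?memv_line.
Qed.

End Cobracket.
End OscLie.

Unset Implicit Arguments.

Theorem corollary1p1 (R : realType) (n : nat) (lam : 'I_n -> R)
    (n_gt0 : (0 < n)%N) (lam_generic : generic lam)
    (r : dform (osc R n)) (u0 : osc R n) (J : 'End(osc R n))
    (xi : 'Hom(osc R n, dform (osc R n)))
    (r_wedge2S : wedge2S r) (u0_S : u0 \in oscS)
    (J_der : is_derivation (osc_br lam) J)
    (J_comm : (J \o ad (osc_br lam) em1)%VF = (ad (osc_br lam) em1 \o J)%VF)
    (J_em1 : J em1 = 0) (J_e0 : J e0 = 0)
    (xi_def : forall u, xi u = dagger (ad (osc_br lam) u) r
                        + 2 *: wedge e0 ((J + ad (osc_br lam) u0) u))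
    (xi_bialg : is_lie_bialgebra (osc_br lam) xi) :
  [/\ exists p : nat,
        [/\ (p <= n)%N,
            \dim (radical oscSd (dagger (ad (osc_br lam) em1) r)) = (2 * p)%N
          & exists (rho : 'Hom(R^o, 'End((heis R (n - p) * 'rV[R]_(2 * p))%type)))
                   (phi : 'Hom((R^o * (heis R (n - p) * 'rV[R]_(2 * p)))%type,
                               dual (osc R n))),
              let h_br := prod_br (@heis_br R (n - p))
                                  (@abelian_br R 'rV[R]_(2 * p)) in
              [/\ is_lie_action (@abelian_br R R^o) h_br rho,
                  lie_iso (sdprod_br (@abelian_br R R^o) h_br rho)
                          (dual_br xi) phi,
                  phi (1, 0) = e0_dual
                & forall a, a \in (<[em1_dual]> + oscSd)%VS <->
                            exists x, a = phi (0, x)]],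
      forall a, a \in oscSd ->
        dual_br xi e0_dual a
        = 2 *: lstar J a
          - (2 * lstar (ad (osc_br lam) em1) a u0) *: em1_dual
          + iomega (sharp r a),
      dual_br xi e0_dual em1_dual = 0,
      lie_solvable (dual_br xi)
    & unimodular (dual_br xi) <-> \sum_(i < n) r (ei_dual i) (ec_dual i) = 0].
Proof.
have u0_em1 := oscS_em1 u0_S.
have lam0 i : lam i != 0 by case: lam_generic => /(_ i); rewrite lt0r => /andP[].
have J_coord u := commuting_em1_coord u lam0 J_comm J_em1 J_e0.
have two0 : 2%:R != 0 :> R by rewrite pnatr_eq0.
have dbr_lie := dual_br_lie two0 xi_bialg.
split.
- exact: dual_br_sdprod r_wedge2S u0_em1 J_e0 xi_def dbr_lie.
- move=> a aS; have [_ a0] := mem_oscSd _ aS.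
  by rewrite (dual_br_e0 r_wedge2S xi_def a0) e0_actE.
- exact: dual_br_em1r r_wedge2S J_coord xi_def e0_dual.
- exact: dual_br_solvable r_wedge2S u0_em1 J_e0 J_coord xi_def.
- exact: dual_br_unimodular r_wedge2S u0_em1 J_der J_e0 J_coord xi_def.
Qed.
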